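(* Let $A\in\mathbb{R}^{3\times 3}$. Suppose that the singleton supports $\{1\}$ and $\{2\}$ produce Pareto eigenvalues and that the pair supports $\{1,3\}$ and $\{2,3\}$ are rich. Then $|\Pi_{\{1,2,3\}}(A)|\le 2$.
   Context: Vector inequalities are componentwise ($u>0$ means all components are positive). For $A\in\mathbb{R}^{n\times n}$, a support is a nonempty subset $J\subseteq\{1,\dots,n\}$, with complement $J^{\mathrm c}$; $A_J$ is the principal submatrix indexed by $J$ and $A_{J^{\mathrm c},J}$ is the submatrix with rows in $J^{\mathrm c}$ and columns in $J$. The support $J$ produces $\lambda\in\mathbb{R}$ if there is $u\in\mathbb{R}^{|J|}$ with $A_Ju=\lambda u$, $u>0$, $A_{J^{\mathrm c},J}u\ge 0$ (the last condition is empty if $J=\{1,\dots,n\}$). Values produced by some support are exactly the Pareto eigenvalues of $A$. The set of values produced by $J$ is denoted $\Pi_J(A)$. A pair support (support with two elements) is rich if it produces two distinct values. *)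

(* Defs.v *)
From HB Require Import structures.
From mathcomp Require Import all_boot all_order all_algebra.
From mathcomp Require Import classical_sets functions cardinality reals.

Set Implicit Arguments.
Unset Strict Implicit.
Unset Printing Implicit Defensive.

Import Order.TTheory GRing.Theory Num.Theory.
Local Open Scope ring_scope.

(* [subm A I J] is the submatrix of A with rows in I and columns in J; both
   keep the increasing order of 'I_n.  Thus [subm A J J] is A_J and
   [subm A (~: J) J] is A_{J^c, J}, a matrix with no row when J is full. *)
Definition subm (R : realType) (n : nat) (A : 'M[R]_n) (I J : {set 'I_n}) :
    'M[R]_(#|I|, #|J|) :=
  mxsub (fun i : 'I_#|I| => enum_val i) (fun j : 'I_#|J| => enum_val j) A.

(* Without [J != finset.set0], the empty set would produce every real number. *)
Definition produces (R : realType) (n : nat) (A : 'M[R]_n) (J : {set 'I_n})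
    (lambda : R) : Prop :=
  J != finset.set0 /\
  exists u : 'cV[R]_#|J|,
    [/\ subm A J J *m u = lambda *: u,
        forall i, 0 < u i 0
      & forall i, 0 <= (subm A (~: J) J *m u) i 0].

Definition produced_values (R : realType) (n : nat) (A : 'M[R]_n)
    (J : {set 'I_n}) : set R :=
  [set lambda | produces A J lambda]%classic.

Definition rich (R : realType) (n : nat) (A : 'M[R]_n) (J : {set 'I_n}) :
    Prop :=
  #|J| = 2%N /\
  exists lambda mu : R, [/\ lambda <> mu, produces A J lambda & produces A J mu].

(* Main.v *)
(* Shift A so that a_33 = 0 and write r, s and t, w for the two values produced by {1,3} and {2,3}
   (r < s, t < w). An eigenvector (x, y, z) of A satisfies, once z is eliminated,
     (l - r)(l - s) x = (a_12 l + a_13 a_32) y,   (l - t)(l - w) y = (a_21 l + a_23 a_31) x,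
   and the product of the two relations, divided by l, is the characteristic cubic.
   Say r <= t and put k = - a_23 a_31 / a_21; the sign conditions give 0 < k <= r. Positivity of x
   and y forces l >= k, while the characteristic cubic is nonnegative at k: three distinct roots
   l >= k can only occur if k is a root, which degenerates to k = r = t, and then the
   quadratic with the two other roots is nonpositive at k, so these cannot both exceed k. *)
Require Import Defs.
From HB Require Import structures.
From mathcomp Require Import all_boot all_order all_algebra.
From mathcomp Require Import classical_sets functions cardinality reals.
From mathcomp Require Import boolp ring lra.

Import Order.TTheory GRing.Theory Num.Theory.
Local Open Scope ring_scope.

Set Implicit Arguments.
Unset Strict Implicit.
Unset Printing Implicit Defensive.

Lemma card_le2 (T : Type) (S : set T) :
  (forall a b c, S a -> S b -> S c -> [\/ a = b, a = c | b = c]) ->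
  (S #<= `I_2)%card.
Proof.
move=> H.
have [->|/set0P[a Sa]] := eqVneq S classical_sets.set0; first exact: card_ge0.
suff [b Sab] : exists b, forall c, S c -> c = a \/ c = b.
  apply: (@card_le_trans _ _ _ ((fun n => if n is 0%N then a else b) @` `I_2)%classic);
    last exact: card_image_le.
  by apply: subset_card_le => c /Sab[->|->]; [exists 0%N | exists 1%N].
have [[b [Sb nab]]|nS] := pselect (exists b, S b /\ a <> b).
  by exists b => c Sc; case: (H a b c Sa Sb Sc) => [//|->|->]; [left|right].
by exists a => c Sc; left; apply: contrapT => nca; apply: nS; exists c; split=> // /esym.
Qed.

(** The eigenvector is moved from ['I_#|J|] to a function on ['I_n], so that concrete sets of
    indices give plain sums. *)
Lemma produces_col (R : realType) (n : nat) (A : 'M[R]_n) (J : {set 'I_n})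
    (l : R) : produces A J l ->
  exists v : 'I_n -> R,
    [/\ forall i, i \in J -> 0 < v i,
        forall i, i \in J -> \sum_(j in J) A i j * v j = l * v i
      & forall i, i \notin J -> 0 <= \sum_(j in J) A i j * v j].
Proof.
case=> _ [u [Au u_gt0 Acu]].
(* At most one [k] contributes, and none when [i] is outside [J]; this inverts [enum_val] without a
   membership proof. *)
pose v i := \sum_(k | enum_val k == i) u k 0.
have vE k : v (enum_val k) = u k 0.
  by rewrite /v (big_pred1 k) // => k' /=; rewrite (inj_eq enum_val_inj).
have mulE (I : {set 'I_n}) i :
    (subm A I J *m u) i 0 = \sum_(j in J) A (enum_val i) j * v j.
  by rewrite big_enum_val mxE; apply: eq_bigr => k _; rewrite mxE vE.
exists v; split=> i iJ.
- by rewrite -(enum_rankK_in iJ iJ) vE.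
- by rewrite -(enum_rankK_in iJ iJ) vE -mulE Au mxE.
- have iJC : i \in ~: J by rewrite inE.
  by rewrite -(enum_rankK_in iJC iJC) -mulE.
Qed.

Section RealField.
Variable R : realFieldType.

(** Chained applications subtract multiples of hypotheses from the goal until [ring] can close
    it. *)
Lemma eq_lincomb (x y u v a : R) : x = y -> u - v = a * (x - y) -> u = v.
Proof. by move=> -> /eqP; rewrite subrr mulr0 subr_eq0 => /eqP. Qed.

Arguments eq_lincomb [x y u v] a _ _.

Lemma cubic_vieta (a b c x y z : R) : x != y -> x != z -> y != z ->
  x ^+ 3 + a * x ^+ 2 + b * x + c = 0 ->
  y ^+ 3 + a * y ^+ 2 + b * y + c = 0 ->
  z ^+ 3 + a * z ^+ 2 + b * z + c = 0 ->
  [/\ a = - (x + y + z), b = x * y + x * z + y * z & c = - (x * y * z)].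
Proof.
move=> xy xz yz Hx Hy Hz.
(* First divided difference of the cubic; the second one gives [a]. *)
have Hxy : x ^+ 2 + x * y + y ^+ 2 + a * (x + y) + b = 0.
  apply: (@mulfI _ (x - y)); first by rewrite subr_eq0.
  by rewrite mulr0; lra.
have Hxz : x ^+ 2 + x * z + z ^+ 2 + a * (x + z) + b = 0.
  apply: (@mulfI _ (x - z)); first by rewrite subr_eq0.
  by rewrite mulr0; lra.
have Ha : a = - (x + y + z).
  apply: (@mulfI _ (y - z)); first by rewrite subr_eq0.
  lra.
have Hb : b = x * y + x * z + y * z by move: Hxy; rewrite Ha; lra.
by split=> //; move: Hx; rewrite Ha Hb; lra.
Qed.

(* The 2 x 2 matrix is [[p, -b], [c, 0]]. *)
Lemma rich_pair (p b c d g l m u v u' v' : R) : l <> m ->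
  0 <= c -> 0 < u -> 0 < v -> 0 < u' -> 0 < v' ->
  p * u - b * v = l * u -> c * u = l * v -> 0 <= g * u - d * v ->
  p * u' - b * v' = m * u' -> c * u' = m * v' -> 0 <= g * u' - d * v' ->
  exists r s : R, [/\ 0 < r < s, p = r + s, b * c = r * s, 0 < b /\ 0 < c
                    & d * s <= g * b].
Proof.
move=> lm c0 u0 v0 u0' v0' E1 E2 E3 F1 F2 F3.
have Hl : (p - l) * l = b * c.
  apply: (@mulIf _ u); first by rewrite gt_eqF.
  apply: (eq_lincomb l E1); apply: (eq_lincomb (- b) E2); ring.
have Hm : (p - m) * m = b * c.
  apply: (@mulIf _ u'); first by rewrite gt_eqF.
  apply: (eq_lincomb m F1); apply: (eq_lincomb (- b) F2); ring.
have Hp : p = l + m.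
  apply: (@mulfI _ (l - m)); first by rewrite subr_eq0; apply/eqP.
  lra.
(* If [c = 0], the second row makes both eigenvalues vanish, against [l <> m]. *)
have {}c0 : 0 < c.
  rewrite lt_def c0 andbT; apply/eqP => c00; apply: lm.
  have /eqP : l * v = 0 by rewrite -E2 c00 mul0r.
  rewrite mulf_eq0 (gt_eqF v0) orbF => /eqP ->.
  have /eqP : m * v' = 0 by rewrite -F2 c00 mul0r.
  by rewrite mulf_eq0 (gt_eqF v0') orbF => /eqP ->.
have l0 : 0 < l by rewrite -(pmulr_lgt0 _ v0) -E2 mulr_gt0.
have m0 : 0 < m by rewrite -(pmulr_lgt0 _ v0') -F2 mulr_gt0.
have bc : b * c = l * m by rewrite -Hl Hp; ring.
have b0 : 0 < b by rewrite -(pmulr_lgt0 _ c0) bc mulr_gt0.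
(* The first row gives [b * v = (p - l) * u = m * u], so the sign condition at the eigenvalue [l]
   bounds the other eigenvalue [m]. *)
have Gm : d * m <= g * b.
  rewrite -(ler_pM2r u0) -subr_ge0.
  have -> : g * b * u - d * m * u = b * (g * u - d * v) by move: E1; rewrite Hp => E1; apply: (eq_lincomb (- d) E1); ring.
  by rewrite mulr_ge0 // ltW.
have Gl : d * l <= g * b.
  rewrite -(ler_pM2r u0') -subr_ge0.
  have -> : g * b * u' - d * l * u' = b * (g * u' - d * v') by move: F1; rewrite Hp => F1; apply: (eq_lincomb (- d) F1); ring.
  by rewrite mulr_ge0 // ltW.
have [lt_lm|lt_ml|//] := ltgtP l m.
- by exists l, m; split=> //; rewrite l0.
- by exists m, l; split=> //; rewrite ?m0 // 1?addrC // bc mulrC.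
Qed.

(** [B] and [K] stand for - a_13 a_32 and - a_23 a_31, which keeps the two relations symmetric under
    exchange of the indices 1 and 2. *)
Definition reduced_eigen (r s t w f g B K l : R) : Prop :=
  0 < l /\ exists x y : R, [/\ 0 < x, 0 < y,
    (l - r) * (l - s) * x = (f * l - B) * y
  & (l - t) * (l - w) * y = (g * l - K) * x].

Lemma reduced_eigen_sym r s t w f g B K l :
  reduced_eigen r s t w f g B K l -> reduced_eigen t w r s g f K B l.
Proof. by case=> l0 [x [y [x0 y0 E1 E2]]]; split=> //; exists y, x. Qed.

Lemma reduced_eigen_root (r s t w f g B K l : R) : B * K = r * s * (t * w) ->
  reduced_eigen r s t w f g B K l ->
  l ^+ 3 + (- (r + s + t + w)) * l ^+ 2
    + (r * s + t * w + (r + s) * (t + w) - f * g) * l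
    + (f * K + g * B - r * s * (t + w) - t * w * (r + s)) = 0.
Proof.
move=> BK [l0 [x [y [x0 y0 E1 E2]]]].
(* In the product of the two relations the constant terms cancel by [BK], which leaves a factor
   [l]. *)
apply: (@mulfI _ (l * (x * y))); first by rewrite !mulf_neq0 // gt_eqF.
rewrite mulr0.
have E : ((l - r) * (l - s) * x) * ((l - t) * (l - w) * y)
       = ((f * l - B) * y) * ((g * l - K) * x) by rewrite E1 E2.
apply: (eq_lincomb 1 E); apply: (eq_lincomb (x * y) BK); ring.
Qed.

(** * Excluding three distinct roots when r <= t *)

Section Reduced.
Variables r s t w f g B K : R.
Hypotheses (rs : r < s) (tw : t < w) (rt : r <= t) (g0 : 0 < g)
  (K0 : 0 < K) (BK : B * K = r * s * (t * w)) (Kg : K <= g * r) (Bf : B <= f * t).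

Local Notation eigen := (reduced_eigen r s t w f g B K).

(** Below K/g <= r <= t < w, the second relation would have a positive left side and a negative
    right side. *)
Lemma reduced_eigen_ge l : eigen l -> K <= g * l.
Proof.
case=> l0 [x [y [x0 y0 _ E2]]]; rewrite leNgt; apply/negP => lK.
have lr : l < r by rewrite -(ltr_pM2l g0); exact: lt_le_trans Kg.
have : 0 < (t - l) * (w - l) * y.
  by rewrite !mulr_gt0 // subr_gt0; move: rt tw => *; lra.
have -> : (t - l) * (w - l) * y = - ((K - g * l) * x) by lra.
by rewrite oppr_gt0 pmulr_llt0 // subr_lt0 ltNge (ltW lK).
Qed.

Lemma reduced_eigen_eq l : eigen l -> g * l = K -> l = t /\ l = r.
Proof.
move=> [l0 [x [y [x0 y0 _ E2]]]] gl.
have lr : l <= r by rewrite -(ler_pM2l g0) gl.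
move: E2; rewrite gl subrr mul0r => /eqP.
rewrite !mulf_eq0 (gt_eqF y0) orbF !subr_eq0 => /orP[] /eqP El; by move: rt tw => *; first [split; lra | exfalso; lra].
Qed.

Lemma no_critical_triple l m n : eigen l -> eigen m -> eigen n ->
  l != m -> l != n -> m != n -> g * l != K.
Proof.
move=> el em en lm ln mn; apply/eqP => gl.
have [lt lr] := reduced_eigen_eq el gl.
have [V1 V2 V3] := cubic_vieta lm ln mn (reduced_eigen_root BK el)
  (reduced_eigen_root BK em) (reduced_eigen_root BK en).
have l0 : 0 < l by case: el.
have gt_l z : eigen z -> l != z -> l < z.
  by move=> ez lz; rewrite lt_neqAle lz -(ler_pM2l g0) gl reduced_eigen_ge.
(* Both sides are the derivative of the cubic at its root [l], where [l = r = t]. *)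
have E : (m - l) * (n - l) = s * w - f * g.
  move: V1 V2; rewrite -lt -lr => V1 V2.
  apply: (eq_lincomb (- 2 * l) V1); apply: (eq_lincomb (- 1) V2); ring.
have gB : s * w * l = g * B.
  apply: (@mulfI _ l); first by rewrite gt_eqF.
  by move: BK; rewrite -gl -lt -lr; lra.
have : 0 < (m - l) * (n - l) * l by rewrite !mulr_gt0 // subr_gt0 gt_l.
have : g * B <= g * (f * l) by rewrite ler_pM2l // lt.
by rewrite E mulrBl gB; lra.
Qed.

Lemma no_reduced_triple l m n : eigen l -> eigen m -> eigen n ->
  l != m -> l != n -> m != n -> False.
Proof.
move=> el em en lm ln mn.
have [V1 V2 V3] := cubic_vieta lm ln mn (reduced_eigen_root BK el)
  (reduced_eigen_root BK em) (reduced_eigen_root BK en).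
have [k gk] : exists k, g * k = K by exists (K / g); rewrite mulrC divfK // gt_eqF.
have k0 : 0 < k by rewrite -(pmulr_rgt0 _ g0) gk.
have kr : k <= r by rewrite -(ler_pM2l g0) gk.
have gt_k z : eigen z -> g * z != K -> 0 < z - k.
  move=> ez gz; rewrite subr_gt0 -(ltr_pM2l g0) gk.
  by rewrite lt_neqAle eq_sym gz reduced_eigen_ge.
have lk := gt_k _ el (no_critical_triple el em en lm ln mn).
have mk : 0 < m - k.
  apply: (gt_k _ em (no_critical_triple em el en _ mn ln)).
  by rewrite eq_sym.
have nk : 0 < n - k.
  by apply: (gt_k _ en (no_critical_triple en el em _ _ lm)); rewrite eq_sym.
have : 0 < k * ((l - k) * (m - k) * (n - k)) by rewrite !mulr_gt0.
(* At [k = K / g] the product (f k - B)(g k - K) vanishes, so [k] times the cubic is the product of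
   the two quadratics. *)
have -> : k * ((l - k) * (m - k) * (n - k))
    = - ((r - k) * (s - k) * ((t - k) * (w - k))).
  move: V1 V2 V3 BK; rewrite -gk => V1 V2 V3 V4.
  apply: (eq_lincomb (k ^+ 3) V1); apply: (eq_lincomb (k ^+ 2) V2).
  apply: (eq_lincomb k V3); apply: (eq_lincomb (- 1) V4); ring.
have : 0 <= (r - k) * (s - k) * ((t - k) * (w - k)).
  by rewrite !mulr_ge0 // subr_ge0; move: rs tw rt => *; lra.
lra.
Qed.

End Reduced.

(* The matrix is [[p, f, -b], [g, q, -d], [c, e, 0]]. *)
Lemma eigen_reduced (p q b c d e f g r s t w l x y z : R) :
  0 < c -> 0 < e -> 0 < x -> 0 < y -> 0 < z ->
  p = r + s -> b * c = r * s -> q = t + w -> d * e = t * w ->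
  p * x + f * y - b * z = l * x -> g * x + q * y - d * z = l * y ->
  c * x + e * y = l * z ->
  reduced_eigen r s t w f g (b * e) (d * c) l.
Proof.
move=> c0 e0 x0 y0 z0 Hp Hbc Hq Hde E1 E2 E3; split.
  by rewrite -(pmulr_lgt0 _ z0) -E3 addr_gt0 // mulr_gt0.
exists x, y; split=> //.
- apply: (eq_lincomb (- l) E1); apply: (eq_lincomb b E3); apply: (eq_lincomb (l * x) Hp); apply: (eq_lincomb (- x) Hbc); ring.
- apply: (eq_lincomb (- l) E2); apply: (eq_lincomb d E3); apply: (eq_lincomb (l * y) Hq); apply: (eq_lincomb (- y) Hde); ring.
Qed.

End RealField.

Unset Implicit Arguments.

(* The indices 1, 2, 3 are the elements 0, 1, 2 of 'I_3. *)
Theorem lemma3p7 (R : realType) (A : 'M[R]_3)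
    (h1 : exists lambda : R, produces A [set (0 : 'I_3)]%SET lambda)
    (h2 : exists lambda : R, produces A [set (1 : 'I_3)]%SET lambda)
    (h13 : rich A [set (0 : 'I_3); (2 : 'I_3)]%SET)
    (h23 : rich A [set (1 : 'I_3); (2 : 'I_3)]%SET) :
  (produced_values A [set: 'I_3]%SET #<= `I_2)%card.
Proof.
have single (i j : 'I_3) : i != j ->
    (exists l, produces A [set i]%SET l) -> 0 <= A j i.
  move=> ij [l /produces_col[v [v0 _]]] /(_ j).
  rewrite big_set1 inE eq_sym => /(_ ij).
  by rewrite pmulr_lge0 // v0 ?inE.
have pair (i j : 'I_3) : i != 2 -> j != 2 -> i != j -> 0 <= A 2 i ->
    rich A [set i; (2 : 'I_3)]%SET ->
    exists r s : R, [/\ 0 < r < s, A i i - A 2 2 = r + s,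
      - A i 2 * A 2 i = r * s, 0 < - A i 2 /\ 0 < A 2 i
    & - A j 2 * s <= A j i * - A i 2].
  move=> i2 j2 ij Ai [_ [l [m [lm /produces_col[u [u0 uE uI]] /produces_col[v [v0 vE vI]]]]]].
  have iI : i \in [set i; (2 : 'I_3)]%SET by rewrite !inE eqxx.
  have I2 : (2 : 'I_3) \in [set i; (2 : 'I_3)]%SET by rewrite !inE eqxx orbT.
  have jI : j \notin [set i; (2 : 'I_3)]%SET by rewrite !inE negb_or eq_sym ij.
  have sumE (F : 'I_3 -> R) : \sum_(k in [set i; (2 : 'I_3)]%SET) F k = F i + F 2.
    by rewrite big_setU1 ?big_set1 // inE.
  move: (uE _ iI) (uE _ I2) (uI _ jI) (vE _ iI) (vE _ I2) (vI _ jI).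
  rewrite !sumE => E1 E2 E3 F1 F2 F3.
  (* Subtracting [A 2 2] from the diagonal shifts both eigenvalues by the same amount. *)
  apply: (@rich_pair R _ _ _ _ _
    (l - A 2 2) (m - A 2 2) (u i) (u 2) (v i) (v 2)); rewrite ?u0 ?v0 //.
  - by move/addIr.
  - lra.
  - lra.
  - by rewrite mulNr opprK.
  - lra.
  - lra.
  - by rewrite mulNr opprK.
have [r [s [/andP[r0 rs] Hp Hbc [b0 c0] Gs]]] :=
  pair 0 1 isT isT isT (single 0 2 isT h1) h13.
have [t [w [/andP[t0 tw] Hq Hde [d0 e0] Fw]]] :=
  pair 1 0 isT isT isT (single 1 2 isT h2) h23.
set b := - A 0 2 in Hbc b0 Gs Fw; set d := - A 1 2 in Hde d0 Gs Fw.
have eigen l : produces A [set: 'I_3]%SET l ->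
    reduced_eigen r s t w (A 0 1) (A 1 0) (b * A 2 1) (d * A 2 0) (l - A 2 2).
  move=> /produces_col[v [v0 vE _]].
  have sumE (F : 'I_3 -> R) : \sum_(k in [set: 'I_3]%SET) F k = F 0 + F 1 + F 2.
    rewrite (eq_bigl xpredT) => [|k]; last by rewrite inE.
    rewrite !big_ord_recl big_ord0 addr0 addrA.
    by congr (F _ + F _ + F _); apply/val_inj.
  move: (vE 0 (finset.in_setT _)) (vE 1 (finset.in_setT _)) (vE 2 (finset.in_setT _)).
  rewrite !sumE => E1 E2 E3.
  apply: (eigen_reduced (x := v 0) (y := v 1) (z := v 2)
    c0 e0 _ _ _ Hp Hbc Hq Hde); rewrite ?v0 ?finset.in_setT //.
  - rewrite /b; lra.
  - rewrite /d; lra.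
  - lra.
have g0 : 0 < A 1 0.
  rewrite -(pmulr_lgt0 _ b0); apply: lt_le_trans Gs.
  by rewrite mulr_gt0 // (lt_trans r0).
have f0 : 0 < A 0 1.
  rewrite -(pmulr_lgt0 _ d0); apply: lt_le_trans Fw.
  by rewrite mulr_gt0 // (lt_trans t0).
(* After multiplication by [b], the identity b a_31 = r s turns this into [r] times [Gs]. *)
have Kg : d * A 2 0 <= A 1 0 * r.
  rewrite -(ler_pM2l b0).
  have -> : b * (d * A 2 0) = r * (d * s) by rewrite mulrCA Hbc; ring.
  have -> : b * (A 1 0 * r) = r * (A 1 0 * b) by ring.
  by rewrite ler_pM2l.
have Bf : b * A 2 1 <= A 0 1 * t.
  rewrite -(ler_pM2l d0).
  have -> : d * (b * A 2 1) = t * (b * w) by rewrite mulrCA Hde; ring.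
  have -> : d * (A 0 1 * t) = t * (A 0 1 * d) by ring.
  by rewrite ler_pM2l.
have BK : b * A 2 1 * (d * A 2 0) = r * s * (t * w) by rewrite -Hbc -Hde; ring.
apply: card_le2 => l m n /eigen el /eigen em /eigen en.
have [->|lm] := eqVneq l m; first exact: Or31.
have [->|ln] := eqVneq l n; first exact: Or32.
have [->|mn] := eqVneq m n; first exact: Or33.
have neq x y : x != y -> x - A 2 2 != y - A 2 2 by rewrite (inj_eq (addIr _)).
(* Exchanging the indices 1 and 2 reduces t <= r to r <= t. *)
exfalso; have [rt|/ltW tr] := leP r t.
  apply: (no_reduced_triple rs tw rt g0 _ BK Kg Bf el em en);
    by [rewrite mulr_gt0 | apply: neq].
apply: (no_reduced_triple tw rs tr f0 _ _ Bf Kg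
  (reduced_eigen_sym el) (reduced_eigen_sym em)
  (reduced_eigen_sym en)); by [rewrite mulr_gt0 | apply: neq | rewrite mulrC BK mulrC].
Qed.
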